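(* Let $d\ge1$ and let $\mathbf X_0$ be a random vector in $\mathbb Z^d$ having probability mass function $\pi(\mathbf x)=\mathbb P(\mathbf X_0=\mathbf x)$, $\mathbf x\in\mathbb Z^d$. Let $r\in[2,\infty)$. If $\phi\in[0,1]$ is a number, and $\mathbf z\in\mathbb Z^d$ and $\mathbf m\in\mathbb R^d$ are any deterministic vectors, then $$\|\mathbf z\|^r\sum_{\mathbf x\in\mathbb Z^d}\min\{\phi\,\pi(\mathbf x),(1-\phi)\,\pi(\mathbf x-\mathbf z)\}\le2^{r-2}\,\mathbb E\|\mathbf X_0-\mathbf m\|^r.$$ Furthermore, for any $\mathbf c\in\mathbb R^d$ and $m\in\mathbb R$, $$|\langle\mathbf c,\mathbf z\rangle|^r\sum_{\mathbf x\in\mathbb Z^d}\min\{\phi\,\pi(\mathbf x),(1-\phi)\,\pi(\mathbf x-\mathbf z)\}\le2^{r-2}\,\mathbb E|\langle\mathbf c,\mathbf X_0\rangle-m|^r.$$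
   Context: $\langle\cdot,\cdot\rangle$ and $\|\cdot\|$ are the Euclidean inner product and norm on $\mathbb R^d$. The right-hand sides are allowed to be $+\infty$. *)

(* Defs.v *)
From HB Require Import structures.
From mathcomp Require Import all_boot all_order all_algebra.
From mathcomp Require Import all_classical all_reals all_analysis.

Set Implicit Arguments.
Unset Strict Implicit.
Unset Printing Implicit Defensive.

Import Order.TTheory GRing.Theory Num.Theory.
Import numFieldNormedType.Exports.

Local Open Scope classical_set_scope.
Local Open Scope ring_scope.

(* Z^d with its group structure and the discrete sigma-algebra (all subsets),
   so that [X : {RV P >-> Zvec d}] is a Z^d-valued random vector. *)
Definition Zvec (d : nat) : Type := 'rV[int]_d.

HB.instance Definition _ (d : nat) := GRing.Zmodule.on (Zvec d).
HB.instance Definition _ (d : nat) := isPointed.Build (Zvec d) 0.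
HB.instance Definition _ (d : nat) :=
  @isMeasurable.Build default_measure_display (Zvec d)
    discrete_measurable discrete_measurable0
    discrete_measurableC discrete_measurableU.

(* Inclusion of Z^d into R^d. *)
Definition toR (R : realType) (d : nat) (x : Zvec d) : 'rV[R]_d :=
  map_mx intr (x : 'rV[int]_d).
Arguments toR R {d} x.

Definition dotv (R : realType) (d : nat) (u v : 'rV[R]_d) : R :=
  \sum_(i < d) u 0 i * v 0 i.

(* The library norm [`| u |] on row vectors is the sup norm. *)
Definition enorm (R : realType) (d : nat) (u : 'rV[R]_d) : R :=
  Num.sqrt (dotv u u).

(* The library's [pmf] is restricted to real-valued random variables. *)
Definition vpmf (disp : measure_display) (T : measurableType disp)
    (R : realType) (P : probability T R) (d : nat) (X : {RV P >-> Zvec d})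
    (x : Zvec d) : R :=
  fine (P (X @^-1` [set x])).

(* Main.v *)
Require Import Defs.
From HB Require Import structures.
From mathcomp Require Import all_boot all_order all_algebra.
From mathcomp Require Import all_classical all_reals all_analysis.
From mathcomp Require Import measurable_realfun ring lra.

Set Implicit Arguments.
Unset Strict Implicit.
Unset Printing Implicit Defensive.

Import Order.TTheory GRing.Theory Num.Theory.
Import numFieldNormedType.Exports.

Local Open Scope classical_set_scope.
Local Open Scope ring_scope.

(** Everything reduces to one dimension. Put f(x) = <c, x> - m and h = <c, z>,
so that f(x - z) = f(x) - h, and say h > 0 (a sign change of f covers h < 0).
Write q(x) for the minimum in the sum. In general |a + b|^r costs a factor
2^(r-1), so charging h^r q(x) to both x and x - z each time would lose a factor
2. The gain comes from charging x only if f(x) > 0 and x - z only if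
f(x - z) < 0:
  - if f(x) >= h, then h^r q(x) <= f(x)^r pi(x) already;
  - if f(x) <= 0, then h^r q(x) <= |f(x - z)|^r pi(x - z);
  - if 0 < f(x) < h, then h = u + v with u = f(x) and v = |f(x - z)| positive,
    and h^r q(x) <= 2^(r-2) (pi(x) u^r + pi(x - z) v^r) ([min_powRD_le]).
This is [min_step_le]. After summation a given point y is charged at most once,
either as x or as x - z, according to the sign of f(y); hence the total is at most
2^(r-2) times the sum of |f(y)|^r pi(y) ([esum_min_shift_le]).

The sharp constant in the third case has two sources: convexity of t^(r/2),
which gives (u + v)^r <= 2^(r-2) (u^(r/2) + v^(r/2))^2, and the Cauchy-Schwarz
bound (U + V)^2 <= U^2 / phi + V^2 / (1 - phi), together with q / phi <= pi(x)
and q / (1 - phi) <= pi(x - z).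

The inequality with Euclidean norms is the case where c is the unit vector in
the direction z: then <c, z> is the norm of z, and |<c, x - m>| is at most the
norm of x - m. *)

Lemma powR_half_sqr (R : realType) (x r : R) : 0 <= x ->
  (x `^ (r / 2)) ^+ 2 = x `^ r.
Proof. by move=> x0; rewrite -powR_mulrn ?powR_ge0// -powRrM divfK. Qed.

(** Midpoint convexity of t `^ (r / 2), squared. Keeping the square of a sum
on the right, instead of u `^ r + v `^ r, is what leaves room for the weights
phi and 1 - phi. *)
Lemma powRD_le (R : realType) (r u v : R) : 2 <= r -> 0 <= u -> 0 <= v ->
  (u + v) `^ r <= 2 `^ (r - 2) * (u `^ (r / 2) + v `^ (r / 2)) ^+ 2.
Proof.
move=> r2 u0 v0; set U := u `^ (r / 2); set V := v `^ (r / 2).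
have r1 : 1 <= r / 2 by lra.
have mid : (2^-1 * u + 2^-1 * v) `^ (r / 2) <= 2^-1 * U + 2^-1 * V.
  rewrite (_ : 2^-1 * v = (1 - 2^-1) * v); last by field.
  rewrite (_ : 2^-1 * V = (1 - 2^-1) * V); last by field.
  have h1 : (2^-1 : R) <= 1 by lra.
  have h0 : 0 <= (2^-1 : R) by lra.
  by apply: (convex_powR r1 (Itv01 h0 h1)); rewrite inE/= in_itv/= ?u0 ?v0.
(* The midpoint is brought out so that (u + v) `^ r splits off 2 `^ r. *)
have -> : u + v = 2 * (2^-1 * u + 2^-1 * v) by field.
set w := 2^-1 * u + 2^-1 * v in mid *.
have w0 : 0 <= w by rewrite /w; lra.
rewrite powRM// powRB ?pnatr_eq0 ?implybT// powR_mulrn//.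
rewrite -(powR_half_sqr _ w0) -mulrA ler_wpM2l ?powR_ge0//.
have := lerXn2r 2 (powR_ge0 w (r / 2)) _ mid; rewrite nnegrE => h.
apply: (le_trans (h _)); first by rewrite addr_ge0 ?mulr_ge0 ?invr_ge0 ?powR_ge0.
by rewrite le_eqVlt; apply/orP; left; apply/eqP; field.
Qed.

(** With q the minimum, q / phi <= a and q / (1 - phi) <= b reduce this to
(u + v)^2 <= u^2 / phi + v^2 / (1 - phi), where the difference of the two sides
is ((1 - phi) u - phi v)^2 / (phi (1 - phi)). The degenerate weights phi = 0
and phi = 1 make the minimum nonpositive. *)
Lemma min_sqrD_le (R : realFieldType) (phi a b u v : R) :
  0 <= phi <= 1 -> 0 <= a -> 0 <= b ->
  Num.min (phi * a) ((1 - phi) * b) * (u + v) ^+ 2 <= a * u ^+ 2 + b * v ^+ 2.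
Proof.
move=> /andP[p0 p1] a0 b0; set q := Num.min _ _.
have qa : q <= phi * a by rewrite ge_min lexx.
have qb : q <= (1 - phi) * b by rewrite ge_min lexx orbT.
have [q0|q0] := leP q 0.
  have := mulr_ge0 a0 (sqr_ge0 u); have := mulr_ge0 b0 (sqr_ge0 v).
  by have := mulr_le0_ge0 q0 (sqr_ge0 (u + v)); lra.
have {}p0 : 0 < phi.
  by rewrite lt_neqAle p0 andbT; apply/eqP => e; move: qa; rewrite -e; lra.
have {}p1 : 0 < 1 - phi.
  by rewrite lt_neqAle subr_ge0 p1 andbT; apply/eqP => e; move: qb; rewrite -e; lra.
have Ha : q / phi <= a by rewrite ler_pdivrMr// mulrC.
have Hb : q / (1 - phi) <= b by rewrite ler_pdivrMr// mulrC.
apply: (@le_trans _ _ (q / phi * u ^+ 2 + q / (1 - phi) * v ^+ 2)); last first.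
  by rewrite lerD// ler_wpM2r ?sqr_ge0.
rewrite -subr_ge0.
have -> : q / phi * u ^+ 2 + q / (1 - phi) * v ^+ 2 -
   q * (u + v) ^+ 2 =
   q * ((1 - phi) * u - phi * v) ^+ 2 / (phi * (1 - phi)).
  by field; rewrite !gt_eqF.
by rewrite divr_ge0// mulr_ge0// ?sqr_ge0// ltW.
Qed.

Lemma min_powRD_le (R : realType) (phi a b r u v : R) :
  0 <= phi <= 1 -> 0 <= a -> 0 <= b -> 2 <= r -> 0 <= u -> 0 <= v ->
  Num.min (phi * a) ((1 - phi) * b) * (u + v) `^ r <=
  2 `^ (r - 2) * (a * u `^ r + b * v `^ r).
Proof.
move=> phi01 a0 b0 r2 u0 v0.
have q0 : 0 <= Num.min (phi * a) ((1 - phi) * b).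
  by case/andP: phi01 => ? ?; rewrite le_min !mulr_ge0 ?subr_ge0.
apply: le_trans (ler_wpM2l q0 (powRD_le r2 u0 v0)) _.
rewrite mulrCA ler_wpM2l ?powR_ge0//.
by rewrite -!(powR_half_sqr r) // min_sqrD_le.
Qed.

(** Here t and t - h stand for the values of f at a point and at its translate.
The two sign conditions are what makes the later summation lossless: a point
never contributes both as the first and as the second term. *)
Lemma min_step_le (R : realType) (phi a b r h t : R) :
  0 <= phi <= 1 -> 0 <= a -> 0 <= b -> 2 <= r -> 0 < h ->
  h `^ r * Num.min (phi * a) ((1 - phi) * b) <=
  (if 0 < t then 2 `^ (r - 2) * (a * `|t| `^ r) else 0) +
  (if t - h < 0 then 2 `^ (r - 2) * (b * `|t - h| `^ r) else 0).
Proof.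
move=> phi01 a0 b0 r2 h0; case/andP: (phi01) => p0 p1.
have C1 : 1 <= 2 `^ (r - 2) :> R.
  by rewrite -[leLHS](powRr0 2) ler_powR ?subr_ge0// ler1n.
have hr : 0 <= h `^ r := powR_ge0 _ _.
have mono s : h <= s -> h `^ r <= s `^ r.
  by move=> hs; apply: ge0_ler_powR => //; rewrite ?nnegrE; lra.
(* When a single distance s already exceeds h, the weight p <= 1 and the
   constant 2 `^ (r - 2) >= 1 are simply thrown away. *)
have one_sided (p c s : R) : 0 <= p <= 1 -> 0 <= c -> h <= s ->
    h `^ r * (p * c) <= 2 `^ (r - 2) * (c * s `^ r).
  move=> /andP[pp0 pp1] c0 /mono hs.
  have pc : 0 <= p * c by rewrite mulr_ge0.
  apply: (@le_trans _ _ (1 * (c * s `^ r))); last first.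
    by rewrite ler_wpM2r// mulr_ge0// powR_ge0.
  rewrite mul1r mulrC ler_pM//; rewrite -[leRHS]mul1r ler_wpM2r//.
have [t0|t0] := ltP 0 t; have [th|th] := ltP (t - h) 0; last by lra.
- rewrite (gtr0_norm t0) (ltr0_norm th) -mulrDr mulrC.
  by rewrite {1}(_ : h = t + - (t - h)); [apply: min_powRD_le => //; lra|lra].
- rewrite addr0 (gtr0_norm t0); apply: le_trans (one_sided phi a t phi01 a0 _).
    by rewrite ler_wpM2l// ge_min lexx.
  by lra.
- rewrite add0r (ltr0_norm th).
  apply: le_trans (one_sided (1 - phi) b (- (t - h)) _ b0 _).
  + by rewrite ler_wpM2l// ge_min lexx orbT.
  + lra.
  + lra.
Qed.

Lemma esumZl (R : realType) (I : choiceType) (D : set I) (k : R)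
    (a : I -> \bar R) :
  0 <= k -> (forall i, 0 <= a i)%E ->
  ((\esum_(i in D) (k%:E * a i)) = k%:E * \esum_(i in D) a i)%E.
Proof.
move=> k0 a0; rewrite /esum -ereal_supZl//; last first.
  apply/set0P; exists 0%E, set0; first exact: fsets_set0.
  by rewrite fsbig_set0.
congr ereal_sup; rewrite image_comp; apply: eq_imagel => A [finA _] /=.
by rewrite ge0_mule_fsumr.
Qed.

(** Sum [min_step_le] over x and translate the second family of terms by z:
the points with f > 0 and those with f < 0 are disjoint. *)
Lemma esum_min_shift_le (R : realType) (V : zmodType) (pi f : V -> R) (z : V)
    (phi r h : R) :
  (forall x, 0 <= pi x) -> 0 <= phi <= 1 -> 2 <= r -> 0 < h ->
  (forall x, f (x - z) = f x - h) ->
  ((h `^ r)%:E * (\esum_(x in [set: V])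
      (Num.min (phi * pi x) ((1 - phi) * pi (x - z)))%:E) <=
   (2 `^ (r - 2))%:E * (\esum_(x in [set: V]) (pi x * `|f x| `^ r)%:E))%E.
Proof.
move=> pi0 phi01 r2 h0 fz; case/andP: (phi01) => p0 p1.
have q0 x : 0 <= Num.min (phi * pi x) ((1 - phi) * pi (x - z)).
  by rewrite le_min !mulr_ge0// subr_ge0.
pose G x := 2 `^ (r - 2) * (pi x * `|f x| `^ r).
have G0 x : 0 <= G x by rewrite !mulr_ge0// powR_ge0.
pose Gp x := if 0 < f x then G x else 0.
pose Gn x := if f x < 0 then G x else 0.
have Gp0 x : (0 <= (Gp x)%:E)%E by rewrite lee_fin /Gp; case: ifP.
have Gn0 x : (0 <= (Gn x)%:E)%E by rewrite lee_fin /Gn; case: ifP.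
rewrite -!esumZl ?powR_ge0//; last first.
  by move=> x; rewrite lee_fin mulr_ge0// powR_ge0.
have shift : ((\esum_(x in [set: V]) (Gn x)%:E) =
    \esum_(x in [set: V]) (Gn (x - z))%:E)%E.
  apply: (@reindex_esum _ _ _ setT setT (fun x : V => x - z)).
  split=> // [x y _ _ /addIr//|y _].
  by exists (y + z) => //; rewrite addrK.
apply: (@le_trans _ _ (\esum_(x in [set: V]) ((Gp x)%:E + (Gn x)%:E))%E).
  rewrite esumD// shift -esumD//; apply: le_esum => x _.
  rewrite -EFinM -EFinD lee_fin /Gp /Gn /G fz.
  exact: min_step_le.
apply: le_esum => x _; rewrite -EFinM -EFinD lee_fin -/(G x) /Gp /Gn.
by have [fx|fx|fx] := ltgtP 0 (f x); rewrite ?addr0 ?add0r.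
Qed.

(** Every function on Z^d is measurable for the discrete sigma-algebra. *)
Lemma discrete_measurable_comp (R : realType) (disp : measure_display)
    (T : measurableType disp) (P : probability T R) (d : nat)
    (X : {RV P >-> Zvec d}) (g : Zvec d -> R) :
  measurable_fun [set: T] (fun w => g (X w)).
Proof.
have mg : measurable_fun [set: Zvec d] g by [].
exact: measurableT_comp mg (measurable_funPT X).
Qed.

(** Every finite partial sum is the integral of a simple function bounded by
g (X w), since the events X = x are disjoint. *)
Lemma esum_vpmf_le_expectation (R : realType) (disp : measure_display)
    (T : measurableType disp) (P : probability T R) (d : nat)
    (X : {RV P >-> Zvec d}) (g : Zvec d -> R) :
  (forall x, 0 <= g x) ->
  ((\esum_(x in [set: Zvec d]) (vpmf X x * g x)%:E) <= 'E_P[fun w => g (X w)])%E.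
Proof.
move=> g0; apply: ge_ereal_sup => _ [A [finA _] <-].
have mX x : measurable (X @^-1` [set x]).
  exact: measurable_funPTI.
pose F x w : \bar R := ((g x)%:E * (\1_(X @^-1` [set x]) w)%:E)%E.
have mF x : measurable_fun [set: T] (F x).
  apply: measurable_funeM; apply/measurable_EFinP; exact: measurable_indic.
have F0 x w : (0 <= F x w)%E by rewrite mule_ge0// lee_fin.
have -> : (\sum_(x \in A) (vpmf X x * g x)%:E =
    \int[P]_w (\sum_(x \in A) F x w))%E.
  rewrite ge0_integral_fsum//; apply: eq_fsbigr => x _.
  rewrite ge0_integralZl_EFin//; last first.
    by apply/measurable_EFinP; exact: measurable_indic.
  rewrite integral_indic// setIT EFinM [RHS]muleC; congr (_ * _)%E.
  by apply: fineK; exact: fin_num_measure.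
rewrite expectation.unlock; apply: ge0_le_integral => //.
- by move=> w _; apply: fsume_ge0.
- exact: emeasurable_fsum.
- by apply/measurable_EFinP; exact: discrete_measurable_comp.
- move=> w _; have [wA|wA] := pselect (A (X w)).
    rewrite (fsbigD1 (X w))//= fsbig1 ?adde0.
      by rewrite /F indicE mem_set// mule1.
    move=> x /= [_ xw]; rewrite /F indicE memNset ?mule0// => /= e.
    exact/xw/esym.
  rewrite fsbig1 ?lee_fin// => x Ax; rewrite /F indicE memNset ?mule0// => /= e.
  by apply: wA; rewrite e.
Qed.

Lemma toRB (R : realType) (d : nat) (x y : Zvec d) :
  toR R (x - y) = toR R x - toR R y.
Proof. exact: map_mxB. Qed.

Lemma dotvC (R : realType) (d : nat) (u v : 'rV[R]_d) : dotv u v = dotv v u.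
Proof. by apply: eq_bigr => i _; rewrite mulrC. Qed.

Lemma dotvBr (R : realType) (d : nat) (c u v : 'rV[R]_d) :
  dotv c (u - v) = dotv c u - dotv c v.
Proof.
rewrite /dotv -sumrB; apply: eq_bigr => i _.
by rewrite !mxE mulrBr.
Qed.

Lemma dotvZl (R : realType) (d : nat) (k : R) (u v : 'rV[R]_d) :
  dotv (k *: u) v = k * dotv u v.
Proof. by rewrite /dotv mulr_sumr; apply: eq_bigr => i _; rewrite mxE mulrA. Qed.

Lemma dotv_ge0 (R : realType) (d : nat) (u : 'rV[R]_d) : 0 <= dotv u u.
Proof. by apply: sumr_ge0 => i _; rewrite -expr2 sqr_ge0. Qed.

Lemma enorm_ge0 (R : realType) (d : nat) (u : 'rV[R]_d) : 0 <= enorm u.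
Proof. exact: sqrtr_ge0. Qed.

Lemma sqr_enorm (R : realType) (d : nat) (u : 'rV[R]_d) :
  enorm u ^+ 2 = dotv u u.
Proof. exact: sqr_sqrtr (dotv_ge0 u). Qed.

(** Cauchy-Schwarz against a unit vector, by Pythagoras: the vector
v - <c, v> c has squared norm <v, v> - <c, v>^2. *)
Lemma normr_dotv_le_enorm (R : realType) (d : nat) (c v : 'rV[R]_d) :
  dotv c c = 1 -> `|dotv c v| <= enorm v.
Proof.
move=> c1; rewrite -sqrtr_sqr ler_wsqrtr// -subr_ge0; set s := dotv c v.
have -> : dotv v v - s ^+ 2 = dotv (v - s *: c) (v - s *: c).
  rewrite dotvBr ![dotv (v - _) _]dotvC dotvZl !dotvBr.
  by rewrite ![dotv _ (s *: c)]dotvC !dotvZl c1 -/s; ring.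
exact: dotv_ge0.
Qed.

(** The function f below carries the sign of <c, z>, so that translation by
- z always lowers it, by |<c, z>|. *)
Lemma dotv_moment_le (R : realType) (disp : measure_display)
    (T : measurableType disp) (P : probability T R) (d : nat)
    (X : {RV P >-> Zvec d}) (r phi : R) (z : Zvec d) (c : 'rV[R]_d) (m : R) :
  2 <= r -> 0 <= phi <= 1 ->
  ((`|dotv c (toR R z)| `^ r)%:E *
      (\esum_(x in [set: Zvec d])
        (Num.min (phi * vpmf X x) ((1 - phi) * vpmf X (x - z)))%:E) <=
   (2 `^ (r - 2))%:E * 'E_P[fun w => (`|dotv c (toR R (X w)) - m| `^ r)%R])%E.
Proof.
move=> r2 phi01; set h := dotv c (toR R z).
have C0 : (0 <= (2 `^ (r - 2))%:E :> \bar R)%E by rewrite lee_fin powR_ge0.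
have [->|h0] := eqVneq h 0.
  rewrite normr0 powR0 ?mul0e; last by lra.
  by rewrite mule_ge0// expectation_ge0// => w; rewrite powR_ge0.
pose f x := Num.sg h * (dotv c (toR R x) - m).
have fz x : f (x - z) = f x - `|h|.
  by rewrite /f normrEsg -mulrBr toRB dotvBr -/h; congr (_ * _); ring.
have vpmf0 x : 0 <= vpmf X x by rewrite fine_ge0.
have h_gt0 : 0 < `|h| by rewrite normr_gt0.
apply: le_trans (esum_min_shift_le vpmf0 phi01 r2 h_gt0 fz) _.
rewrite lee_wpmul2l//.
have -> : (\esum_(x in [set: Zvec d]) (vpmf X x * `|f x| `^ r)%:E =
    \esum_(x in [set: Zvec d])
      (vpmf X x * `|dotv c (toR R x) - m| `^ r)%:E)%E.
  by apply: eq_esum => x _; rewrite /f normrM normr_sg h0 mul1r.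
apply: (esum_vpmf_le_expectation X
  (g := fun x => `|dotv c (toR R x) - m| `^ r)) => x.
exact: powR_ge0.
Qed.

Theorem theoremB1 (R : realType) (disp : measure_display)
    (T : measurableType disp) (P : probability T R) (d : nat) (hd : (1 <= d)%N)
    (X0 : {RV P >-> Zvec d}) (r : R) (hr : 2 <= r)
    (phi : R) (hphi : 0 <= phi <= 1) (z : Zvec d) :
  (forall m : 'rV[R]_d,
    ((enorm (toR R z) `^ r)%:E *
       (\esum_(x in [set: Zvec d])
         (Num.min (phi * vpmf X0 x) ((1 - phi) * vpmf X0 (x - z)))%:E)
     <= (2 `^ (r - 2))%:E *
          'E_P[fun w => (enorm (toR R (X0 w) - m) `^ r)%R])%E) /\
  (forall (c : 'rV[R]_d) (m : R),
    ((`| dotv c (toR R z) | `^ r)%:E *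
       (\esum_(x in [set: Zvec d])
         (Num.min (phi * vpmf X0 x) ((1 - phi) * vpmf X0 (x - z)))%:E)
     <= (2 `^ (r - 2))%:E *
          'E_P[fun w => (`| dotv c (toR R (X0 w)) - m | `^ r)%R])%E).

Proof.
split=> [m|c m]; last exact: dotv_moment_le.
have [z0|z0] := eqVneq (enorm (toR R z)) 0.
  rewrite z0 powR0 ?mul0e; last by lra.
  rewrite mule_ge0 ?lee_fin ?powR_ge0// expectation_ge0// => w.
  by rewrite powR_ge0.
set n := enorm (toR R z) in z0 *; pose c := n^-1 *: toR R z.
have cz : dotv c (toR R z) = n by rewrite dotvZl -sqr_enorm expr2 mulKf.
have c1 : dotv c c = 1 by rewrite {1}/c dotvZl dotvC cz mulVf.
have := dotv_moment_le X0 z c (dotv c m) hr hphi.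
rewrite cz ger0_norm ?enorm_ge0// => /le_trans; apply.
rewrite lee_wpmul2l ?lee_fin ?powR_ge0//.
apply: expectation_le.
- exact: (discrete_measurable_comp X0
    (fun x => `|dotv c (toR R x) - dotv c m| `^ r)).
- exact: (discrete_measurable_comp X0 (fun x => enorm (toR R x - m) `^ r)).
- by move=> w; exact: powR_ge0.
- by move=> w; exact: powR_ge0.
- apply: aeW => w; rewrite -dotvBr.
  by apply: ge0_ler_powR; rewrite ?nnegrE ?enorm_ge0 ?normr_dotv_le_enorm//; lra.
Qed.
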